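(* Let $\mathcal{A}\in\mathbb{R}_{\le d}[t]^{n\times n}$, let $V\subseteq\mathbb{R}_{\le d}[t]^{n\times n}$ be a linear subspace of admissible perturbations, let $1\le m\le D:=(n-1)d$, and consider the problem $$\min\ \|\Delta\mathcal{A}\|_F^2\quad\text{subject to}\quad \mathrm{Adj}(\mathcal{A}+\Delta\mathcal{A})=\mathcal{F}h,\quad \mathcal{N}_h\mathrm{vec}(h)=1,$$ in the variables $x=(\Delta\mathcal{A},\mathcal{F},h)$, with Lagrangian $L$. Let $z^\star=(x^\star,\lambda^\star)$, where $x^\star$ is an (attainable) solution and $\lambda^\star$ is a vector of Lagrange multipliers, so $\nabla L(z^\star)=0$, and suppose that the second-order sufficiency condition holds at $z^\star$: $y^T\nabla_{xx}^2L(z^\star)y>0$ for every non-zero $y\in\ker J(x^\star)$. Then the Levenberg–Marquardt algorithm for solving $\nabla L=0$ with $\nu_k=\|\nabla L(z^{(k)})\|_2$ has (local) quadratic convergence: there is $r>0$ such that for every initial guess $z^{(0)}$ with $\|z^{(0)}-z^\star\|_2<r$ the iterates $z^{(k)}$ converge quadratically to a point $\hat z$ with $\nabla L(\hat z)=0$.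
   Context: $\mathbb{R}_{\le d}[t]^{n\times n}$ is the space of $n\times n$ matrices of real polynomials of degree at most $d$; $\|\cdot\|_F$ is the Euclidean norm of all coefficients. $\mathrm{Adj}$ is the adjugate (transpose of the cofactor matrix), with entries regarded as having degree at most $D=(n-1)d$. $\mathrm{vec}$ stacks coefficient vectors (padded with zeros up to the degree bound) of polynomials or of all entries of a matrix polynomial. Variables: $\Delta\mathcal{A}\in V$ (described by orthonormal coordinates on $V$), $\mathcal{F}\in\mathbb{R}[t]^{n\times n}$ with entries of degree at most $D-m$, and $h\in\mathbb{R}[t]$ of degree at most $m$ (described by their coefficients). $\mathcal{N}_h\in\mathbb{R}^{1\times(m+1)}$ is a fixed row vector giving a linear normalization of $h$, chosen so that $h$ has non-zero degree (e.g. so that $\mathcal{N}_h\mathrm{vec}(h)$ is the coefficient of $t^m$). The Lagrangian is $$L(x,\lambda)=\|\Delta\mathcal{A}\|_F^2+\lambda^T\begin{pmatrix}\mathrm{vec}(\mathrm{Adj}(\mathcal{A}+\Delta\mathcal{A})-\mathcal{F}h)\\ \mathcal{N}_h\mathrm{vec}(h)-1\end{pmatrix},$$ $J(x)$ is the Jacobian matrix with respect to $x$ of the vector of constraints multiplying $\lambda^T$, and $\nabla L$, $H=\nabla^2L$ are the gradient and Hessian of $L$ with respect to $z=(x,\lambda)$. Levenberg–Marquardt iteration: $z^{(k+1)}=z^{(k)}+\Delta z^{(k)}$, where $\Delta z^{(k)}$ solves $(H^TH+\nu_kI)\Delta z^{(k)}=-H^T\nabla L(z^{(k)})$ with $H=H(z^{(k)})$;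 the iteration stops if $\nabla L(z^{(k)})=0$. Quadratic convergence to $\hat z$ means $z^{(k)}\to\hat z$ and there is a constant $C$ with $\|z^{(k+1)}-\hat z\|_2\le C\|z^{(k)}-\hat z\|_2^2$ for all sufficiently large $k$. *)

(* Defs.v *)
From HB Require Import structures.
From mathcomp Require Import all_boot all_order all_algebra.
From mathcomp Require Import all_classical all_reals all_analysis.
Set Implicit Arguments.
Unset Strict Implicit.
Unset Printing Implicit Defensive.
Import Order.TTheory GRing.Theory Num.Theory numFieldNormedType.Exports.
Local Open Scope classical_set_scope.
Local Open Scope ring_scope.

(* Vectors of R^k are row vectors ['rV[R]_k], following [jacobian]. *)

Section Vectors.
Context {R : realType}.

Definition dot k (u v : 'rV[R]_k) : R := (u *m v^T) 0 0.

(* The library norm of ['rV[R]_k] is the sup norm. *)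
Definition norm2 k (u : 'rV[R]_k) : R := Num.sqrt (dot u u).

Definition gradient k (f : 'rV[R]_k -> R) (z : 'rV[R]_k) : 'rV[R]_k :=
  \row_i 'D_(delta_mx 0 i) f z.

(* The library's ['J f z] acts on row vectors from the right; its transpose is
   the matrix whose entry (i, j) is the derivative of f_i in the variable j. *)
Definition jacobian_mx k l (f : 'rV[R]_k -> 'rV[R]_l) (z : 'rV[R]_k)
  : 'M[R]_(l, k) := ('J f z)^T.

Definition hessian k (f : 'rV[R]_k -> R) (z : 'rV[R]_k) : 'M[R]_k :=
  jacobian_mx (gradient f) z.

(* Once the gradient vanishes the iteration stops, which is encoded by a
   constant continuation of the sequence. *)
Definition LM_step k (f : 'rV[R]_k -> R) (z z' : 'rV[R]_k) : Prop :=
  let g := gradient f z in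
  let H := hessian f z in
  (g = 0 -> z' = z) /\
  (g <> 0 -> exists dz : 'rV[R]_k,
     (H^T *m H + (norm2 g)%:M) *m dz^T = - (H^T *m g^T) /\ z' = z + dz).

Definition LM_iterates k (f : 'rV[R]_k -> R) (z : nat -> 'rV[R]_k) : Prop :=
  forall i, LM_step f (z i) (z i.+1).

Definition converges_quadratically k (z : nat -> 'rV[R]_k) (zhat : 'rV[R]_k)
  : Prop :=
  z @ \oo --> zhat /\
  exists C : R, \forall i \near \oo,
    norm2 (z i.+1 - zhat) <= C * norm2 (z i - zhat) ^+ 2.

Lemma dot_ge0 k (u : 'rV[R]_k) : 0 <= dot u u.
Proof. by rewrite /dot mxE sumr_ge0 // => i _; rewrite mxE -expr2 sqr_ge0. Qed.

Lemma dot_eq0 k (u : 'rV[R]_k) : (dot u u == 0) = (u == 0).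
Proof.
apply/idP/eqP => [|->]; last by rewrite /dot mul0mx mxE.
rewrite /dot mxE psumr_eq0 => [/allP u0|i _]; last by rewrite mxE -expr2 sqr_ge0.
apply/rowP => i; have := u0 i (mem_index_enum i).
by rewrite !mxE /= -expr2 sqrf_eq0 => /eqP.
Qed.

Lemma norm2_gt0 k (u : 'rV[R]_k) : (0 < norm2 u) = (u != 0).
Proof. by rewrite sqrtr_gt0 lt_neqAle dot_ge0 andbT eq_sym dot_eq0. Qed.

Lemma LM_matrix_unit k (H : 'M[R]_k) (nu : R) :
  0 < nu -> H^T *m H + nu%:M \in unitmx.
Proof.
move=> nu0; rewrite -row_free_unit -kermx_eq0; apply/eqP/row_matrixP => i.
rewrite row0; set v := row i _.
have v0 : v *m (H^T *m H + nu%:M) = 0 by rewrite -row_mul mulmx_ker row0.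
have : dot (v *m H^T) (v *m H^T) + nu * dot v v = 0.
  have := congr1 (fun w => (w *m v^T) 0 0) v0.
  rewrite /= mul0mx mulmxDr mulmxDl mul_mx_scalar -scalemxAl !mxE => <-.
  by rewrite /dot trmx_mul trmxK !mulmxA; congr (_ + _); rewrite mxE.
move/eqP; rewrite paddr_eq0 ?dot_ge0 ?mulr_ge0 ?dot_ge0 ?ltW //.
by move=> /andP[_]; rewrite mulf_eq0 gt_eqF //= dot_eq0 => /eqP.
Qed.

Lemma LM_step_exists k (f : 'rV[R]_k -> R) (z : 'rV[R]_k) :
  exists z', LM_step f z z'.
Proof.
have [g0|g0] := eqVneq (gradient f z) 0.
  by exists z; split => // /(_ g0).
set H := hessian f z; set g := gradient f z.
have U : H^T *m H + (norm2 g)%:M \in unitmx by rewrite LM_matrix_unit ?norm2_gt0.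
exists (z + (invmx (H^T *m H + (norm2 g)%:M) *m - (H^T *m g^T))^T).
split=> [/eqP|_]; first by rewrite (negPf g0).
exists (invmx (H^T *m H + (norm2 g)%:M) *m - (H^T *m g^T))^T; split => //.
rewrite -/H -/g; move: H g U => H g U.
by rewrite trmxK mulmxA mulmxV // mul1mx.
Qed.

End Vectors.

Section MatrixPolynomials.
Context {R : realType}.
Implicit Types (n e : nat).

Definition deg_le n e (P : 'M[{poly R}]_n) : Prop :=
  forall i j, (size (P i j) <= e.+1)%N.

(* Column-stacking of the entries, each entry replaced by its coefficients of
   degree 0, ..., e. *)
Definition vecmx n e (P : 'M[{poly R}]_n) : 'rV[R]_(n * n * e.+1) :=
  mxvec (\matrix_k (poly_rV (mxvec P^T 0 k) : 'rV[R]_e.+1)).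

Definition unvecmx n e (v : 'rV[R]_(n * n * e.+1)) : 'M[{poly R}]_n :=
  (vec_mx (\row_k rVpoly (row k (vec_mx v))))^T.

Lemma unvecmxK n e : cancel (@unvecmx n e) (vecmx e).
Proof.
move=> v; rewrite /vecmx /unvecmx trmxK vec_mxK -[RHS]vec_mxK; congr mxvec.
by apply/row_matrixP => k; rewrite rowK mxE rVpolyK.
Qed.

Lemma vecmxK n e (P : 'M[{poly R}]_n) :
  deg_le e P -> unvecmx (vecmx e P) = P.
Proof.
move=> dP; rewrite /vecmx /unvecmx mxvecK -[RHS]trmxK; congr trmx.
rewrite -[RHS]mxvecK; congr vec_mx; apply/rowP => k; rewrite mxE rowK.
by case/mxvec_indexP: k => i j; rewrite mxvecE mxE poly_rV_K.
Qed.

Lemma unvecmx_deg_le n e (v : 'rV[R]_(n * n * e.+1)) : deg_le e (unvecmx v).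
Proof. by move=> i j; rewrite !mxE size_poly. Qed.

Definition frob n d (P : 'M[{poly R}]_n) : R := norm2 (vecmx d P).

Definition linear_subspace n d (V : set 'M[{poly R}]_n) : Prop :=
  [/\ forall P, V P -> deg_le d P,
      V 0 &
      forall (c : R) P Q, V P -> V Q -> V (c%:P *: P + Q)].

Definition lincomb n p (B : 'I_p -> 'M[{poly R}]_n) (u : 'rV[R]_p)
  : 'M[{poly R}]_n := \sum_i (u 0 i)%:P *: B i.

Definition orthonormal_basis n d p (V : set 'M[{poly R}]_n)
    (B : 'I_p -> 'M[{poly R}]_n) : Prop :=
  [/\ forall i, V (B i),
      forall i j, dot (vecmx d (B i)) (vecmx d (B j)) = (i == j)%:R &
      forall P, V P -> exists u : 'rV[R]_p, P = lincomb B u].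

End MatrixPolynomials.

Section Problem.
Context {R : realType}.
Variables (n d m p : nat).

Definition adj_deg : nat := (n.-1 * d)%N.

Definition nvars : nat := (p + (n * n * (adj_deg - m).+1 + m.+1))%N.

Definition nconstr : nat := (n * n * adj_deg.+1 + 1)%N.

Variables (A : 'M[{poly R}]_n) (B : 'I_p -> 'M[{poly R}]_n) (Nh : 'rV[R]_m.+1).

(* x = (coordinates of Delta A in the basis B of V, vec F, vec h) *)
Definition dA (x : 'rV[R]_nvars) : 'M[{poly R}]_n := lincomb B (lsubmx x).

Definition Fpart (x : 'rV[R]_nvars) : 'M[{poly R}]_n :=
  unvecmx (lsubmx (rsubmx x)).

Definition hpart (x : 'rV[R]_nvars) : {poly R} := rVpoly (rsubmx (rsubmx x)).

Definition normalize (h : {poly R}) : R := (Nh *m (poly_rV h)^T) 0 0.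

Definition feasible (x : 'rV[R]_nvars) : Prop :=
  \adj (A + dA x) = hpart x *: Fpart x /\ normalize (hpart x) = 1.

Definition is_solution (x : 'rV[R]_nvars) : Prop :=
  feasible x /\
  forall y, feasible y -> frob d (dA x) ^+ 2 <= frob d (dA y) ^+ 2.

Definition constr (x : 'rV[R]_nvars) : 'rV[R]_nconstr :=
  row_mx (vecmx adj_deg (\adj (A + dA x) - hpart x *: Fpart x))
         (const_mx (normalize (hpart x) - 1)).

Definition lagrangian (x : 'rV[R]_nvars) (lam : 'rV[R]_nconstr) : R :=
  frob d (dA x) ^+ 2 + dot lam (constr x).

Definition lagrangian_z (z : 'rV[R]_(nvars + nconstr)) : R :=
  lagrangian (lsubmx z) (rsubmx z).

Definition second_order_sufficient (x : 'rV[R]_nvars) (lam : 'rV[R]_nconstr)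
  : Prop :=
  forall y : 'rV[R]_nvars, y != 0 -> jacobian_mx constr x *m y^T = 0 ->
    0 < (y *m hessian (lagrangian ^~ lam) x *m y^T) 0 0.

(* The normalization forces h to have non-zero degree. *)
Definition nonconstant_normalization : Prop :=
  forall h : {poly R}, (size h <= m.+1)%N -> normalize h = 1 -> (1 < size h)%N.

End Problem.

(* Main.v *)
(* Write H for the Hessian of the Lagrangian.  Second-order sufficiency forces
   ker H(z* ) = {0} x ker J(x* )^T =: T, and the gradient vanishes on all of
   z* + T, so near z* the solution set is this affine space and H has kernel
   exactly T along it, with a uniform lower bound on a complement of T.

   Let e be the component of z - z* transverse to T, so z - e is a solution, and
   let w = e + dz for a Levenberg-Marquardt step dz with nu = |grad L(z)|.  Then
     (H^T H + nu) w = nu e + H^T (H e - grad L(z)) = O(|e|^2),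
   since nu = O(|e|) and, by Taylor's formula at z - e, H e - grad L(z) =
   O(|e|^2).  As nu >= c |e|, this gives w = O(|e|), hence H^T H w = O(|e|^2), and
   the transverse part of w, which is the new e, is O(|e|^2).  No singular value
   decomposition or separate error bound is needed. *)

Require Import Defs.
From mathcomp Require Import all_boot all_order all_algebra.
From mathcomp Require Import all_classical all_reals all_analysis.
From mathcomp Require Import ring lra.
Import Order.TTheory GRing.Theory Num.Theory numFieldNormedType.Exports.
Local Open Scope classical_set_scope.
Local Open Scope ring_scope.
Set Implicit Arguments.
Unset Strict Implicit.
Unset Printing Implicit Defensive.

(** * Sup-norm and Euclidean norm bounds *)

Lemma ler_mx_norm_entry (R : realType) m n (A : 'M[R]_(m, n)) i j :
  `|A i j| <= `|A|.
Proof. by rewrite [leRHS]/Num.norm /= mx_normrE; apply: (le_bigmax _ _ (i, j)). Qed.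

Lemma mx_norm_le (R : realType) m n (A : 'M[R]_(m, n)) c :
  0 <= c -> (forall i j, `|A i j| <= c) -> `|A| <= c.
Proof.
by move=> c0 Ac; rewrite [leLHS]/Num.norm /= mx_normrE; apply: bigmax_le => // -[].
Qed.

Lemma mx_norm_tr (R : realType) m n (A : 'M[R]_(m, n)) : `|A^T| = `|A|.
Proof.
apply/eqP; rewrite eq_le; apply/andP; split;
  apply: mx_norm_le => // i j; first by rewrite mxE ler_mx_norm_entry.
by have := ler_mx_norm_entry A^T j i; rewrite mxE.
Qed.

Lemma ler_norm_mulmx (R : realType) m n p (A : 'M[R]_(m, n)) (B : 'M[R]_(n, p)) :
  `|A *m B| <= n%:R * (`|A| * `|B|).
Proof.
apply: mx_norm_le => [|i j]; first by rewrite !mulr_ge0.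
rewrite mxE (le_trans (ler_norm_sum _ _ _)) // mulr_natl -[X in _ *+ X]card_ord.
rewrite -sumr_const ler_sum // => l _.
by rewrite normrM ler_pM // ler_mx_norm_entry.
Qed.

Lemma norm2_ge0 (R : realType) k (u : 'rV[R]_k) : 0 <= norm2 u.
Proof. exact: sqrtr_ge0. Qed.

Lemma sqr_norm2 (R : realType) k (u : 'rV[R]_k) : norm2 u ^+ 2 = dot u u.
Proof. by rewrite sqr_sqrtr // dot_ge0. Qed.

Lemma ler_norm_dot (R : realType) k (u v : 'rV[R]_k) :
  `|dot u v| <= k%:R * (`|u| * `|v|).
Proof.
by rewrite -[`|v|]mx_norm_tr (le_trans _ (ler_norm_mulmx u v^T)) ?ler_mx_norm_entry.
Qed.

Lemma ler_norm_norm2 (R : realType) k (u : 'rV[R]_k) : `|u| <= norm2 u.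
Proof.
apply: mx_norm_le => [|i j]; first exact: norm2_ge0.
rewrite ord1 -(ler_pXn2r (_ : (0 < 2)%N)) ?nnegrE ?norm2_ge0 //.
rewrite sqr_norm2 real_normK ?num_real // /dot mxE (bigD1 j) //= mxE -expr2.
by rewrite lerDl sumr_ge0 // => l _; rewrite mxE -expr2 sqr_ge0.
Qed.

(** The sharp constant is the square root of k; the cruder [k.+1] avoids a root and stays at least 1
    when k = 0. *)
Lemma ler_norm2_norm (R : realType) k (u : 'rV[R]_k) : norm2 u <= k.+1%:R * `|u|.
Proof.
rewrite -(ler_pXn2r (_ : (0 < 2)%N)) ?nnegrE ?norm2_ge0 ?mulr_ge0 //.
rewrite sqr_norm2 (le_trans (ler_norm _)) // (le_trans (ler_norm_dot _ _)) //.
rewrite exprMn -expr2 ler_wpM2r ?sqr_ge0 // -natrX ler_nat.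
by rewrite (leq_trans (leqnSn _)) // leq_pmulr.
Qed.

(* Pairing the equation with w bounds nu |w|^2 by <q, w>. *)
Lemma LM_resolvent_bound (R : realType) k (A : 'M[R]_k) (nu : R) (w q : 'rV[R]_k) :
  0 < nu -> w *m (A *m A^T + nu%:M) = q -> nu * `|w| <= k%:R * `|q|.
Proof.
move=> nu0 wq.
have [->|w0] := eqVneq w 0; first by rewrite normr0 mulr0 mulr_ge0.
have n0 : 0 < norm2 w by rewrite norm2_gt0.
have le1 : nu * norm2 w ^+ 2 <= dot q w.
  rewrite sqr_norm2 -wq [leRHS]/dot mulmxDr mulmxDl mul_mx_scalar -scalemxAl.
  rewrite [leRHS]mxE [X in _ <= _ + X]mxE lerDr mulmxA -mulmxA -trmx_mul.
  exact: dot_ge0.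
have le2 := le_trans le1 (le_trans (ler_norm _) (ler_norm_dot q w)).
have le3 : nu * norm2 w <= k%:R * `|q|.
  rewrite -(ler_pM2r n0) -mulrA -expr2 (le_trans le2) // mulrA.
  by rewrite ler_wpM2l ?mulr_ge0 ?ler_norm_norm2.
by apply: le_trans le3; rewrite ler_pM2l // ler_norm_norm2.
Qed.

(** * Polynomial functions of a vector *)

(** An inductive closure, so that differentiability, stability under directional derivatives and
    Taylor bounds all come by structural induction, without handling multivariate coefficients. *)
Inductive polyfun (R : realType) (k : nat) : ('rV[R]_k -> R) -> Prop :=
| polyfun_cst c : polyfun (fun=> c)
| polyfun_coord i : polyfun (fun x => x 0 i)
| polyfunD f g : polyfun f -> polyfun g -> polyfun (fun x => f x + g x)
| polyfunM f g : polyfun f -> polyfun g -> polyfun (fun x => f x * g x).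

Lemma polyfun_sum (R : realType) (k : nat) (I : Type) (r : seq I) (P : pred I)
    (F : I -> 'rV[R]_k -> R) :
  (forall i, polyfun (F i)) -> polyfun (fun x => \sum_(i <- r | P i) F i x).
Proof.
move=> pF; elim: r => [|i r IH].
  by under eq_fun do rewrite big_nil; exact: polyfun_cst.
under eq_fun do rewrite big_cons.
by case: (P i) => //; exact: (polyfunD (pF i) IH).
Qed.

Lemma polyfun_comp (R : realType) (k l : nat) (G : 'rV[R]_k -> 'rV[R]_l)
    (f : 'rV[R]_l -> R) :
  (forall i, polyfun (fun x => G x 0 i)) -> polyfun f -> polyfun (f \o G).
Proof.
move=> pG; elim => [c|i|f1 f2 _ p1 _ p2|f1 f2 _ p1 _ p2].
- exact: (@polyfun_cst R k c).
- exact: pG.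
- exact: (polyfunD p1 p2).
- exact: (polyfunM p1 p2).
Qed.

Lemma polyfun_differentiable (R : realType) k (f : 'rV[R]_k -> R) x :
  polyfun f -> differentiable f x.
Proof.
elim => [c|i|f1 f2 _ p1 _ p2|f1 f2 _ p1 _ p2].
- exact: differentiable_cst.
- exact: differentiable_coord.
- exact: differentiableD.
- exact: differentiableM.
Qed.

Lemma polyfun_derivable (R : realType) k (f : 'rV[R]_k -> R) x v :
  polyfun f -> derivable f x v.
Proof. by move=> pf; apply/diff_derivable/polyfun_differentiable. Qed.

Lemma derive_coord (R : realType) k (i : 'I_k) (x v : 'rV[R]_k) :
  'D_v (fun y : 'rV[R]_k => y 0 i) x = v 0 i.
Proof.
have di : derivable (@id 'rV[R]_k) x v by exact: derivable_id.
by have := derive_mx di; rewrite derive_id => /matrixP/(_ 0 i); rewrite mxE => <-.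
Qed.

Lemma polyfun_derive_add (R : realType) k (f g : 'rV[R]_k -> R) x v :
  polyfun f -> polyfun g ->
  'D_v (fun y => f y + g y) x = 'D_v f x + 'D_v g x.
Proof. by move=> pf pg; rewrite deriveD //; exact: polyfun_derivable. Qed.

Lemma polyfun_derive_mul (R : realType) k (f g : 'rV[R]_k -> R) x v :
  polyfun f -> polyfun g ->
  'D_v (fun y => f y * g y) x = f x * 'D_v g x + g x * 'D_v f x.
Proof. by move=> pf pg; rewrite deriveM //; exact: polyfun_derivable. Qed.

Lemma polyfun_derive_sum (R : realType) k n (F : 'I_n -> 'rV[R]_k -> R) x v :
  (forall i, polyfun (F i)) ->
  'D_v (fun y => \sum_i F i y) x = \sum_i 'D_v (F i) x.
Proof.
move=> pF; rewrite -derive_sum => [|i]; last exact: polyfun_derivable.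
by congr (derive _ _ _); apply/funext => y; rewrite fct_sumE.
Qed.

Lemma polyfun_derive (R : realType) k (f : 'rV[R]_k -> R) v :
  polyfun f -> polyfun ('D_v f).
Proof.
elim => [c|i|f1 f2 pf1 p1 pf2 p2|f1 f2 pf1 p1 pf2 p2].
- rewrite (_ : 'D_v _ = fun=> 0); first exact: polyfun_cst.
  by apply/funext => x; rewrite derive_cst.
- rewrite (_ : 'D_v _ = fun=> v 0 i); first exact: polyfun_cst.
  by apply/funext => x; rewrite derive_coord.
- rewrite (_ : 'D_v _ = fun x => 'D_v f1 x + 'D_v f2 x); first exact: polyfunD.
  by apply/funext => x; rewrite polyfun_derive_add.
- rewrite (_ : 'D_v _ = fun x => f1 x * 'D_v f2 x + f2 x * 'D_v f1 x).
    by apply: polyfunD; apply: polyfunM.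
  by apply/funext => x; rewrite polyfun_derive_mul.
Qed.

(** The three bounds are proved together because the remainder of a product involves the values and
    derivatives of both factors. The induction replaces any mean value argument. *)
Lemma polyfun_taylor (R : realType) k (f : 'rV[R]_k -> R) (z0 : 'rV[R]_k) :
  polyfun f -> exists2 K, 0 <= K & forall a b, `|a - z0| <= 1 -> `|b - z0| <= 1 ->
  [/\ `|f b| <= K, `|'D_(b - a) f b| <= K * `|b - a| &
      `|f b - f a - 'D_(b - a) f b| <= K * `|b - a| ^+ 2].
Proof.
have dist a b : `|a - z0| <= 1 -> `|b - z0| <= 1 -> `|b - a| <= 2.
  move=> az bz; rewrite -(subrKA z0) (le_trans (ler_normD _ _)) //.
  by rewrite [`|z0 - a|]distrC (_ : 2 = 1 + 1) ?lerD.
elim => [c|i|f1 f2 pf1 [K1 K10 H1] pf2 [K2 K20 H2]|f1 f2 pf1 [K1 K10 H1] pf2 [K2 K20 H2]].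
- exists `|c| => // a b _ _; rewrite derive_cst !subrr !normr0 lexx.
  by rewrite !mulr_ge0 ?sqr_ge0.
- exists (`|z0| + 1); first by rewrite addr_ge0.
  move=> a b _ bz; rewrite derive_coord !mxE subrr normr0.
  have nz : 0 <= `|z0| by [].
  split; last 1 first.
  + by rewrite mulr_ge0 ?sqr_ge0 ?addr_ge0.
  + rewrite (le_trans (ler_mx_norm_entry b 0 i)) // -[b](subrK z0).
    by rewrite (le_trans (ler_normD _ _)) // addrC lerD2l.
  + have := ler_mx_norm_entry (b - a) 0 i; rewrite !mxE => /le_trans; apply.
    by rewrite ler_peMl // lerDr.
- exists (K1 + K2); first by rewrite addr_ge0.
  move=> a b az bz; have [B1 D1 T1] := H1 a b az bz; have [B2 D2 T2] := H2 a b az bz.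
  rewrite polyfun_derive_add //; split.
  + by rewrite (le_trans (ler_normD _ _)) // lerD.
  + by rewrite (le_trans (ler_normD _ _)) // mulrDl lerD.
  + rewrite (_ : _ - _ - _ = (f1 b - f1 a - 'D_(b - a) f1 b) +
      (f2 b - f2 a - 'D_(b - a) f2 b)); last by ring.
    by rewrite (le_trans (ler_normD _ _)) // mulrDl lerD.
(* 11 = 1 + 1 + 9: two terms pairing a value with a remainder, and a product of two increments, each
   at most 3 K h because |h| <= 2 turns K h + K h^2 into 3 K h. *)
- exists (11 * (K1 * K2)); first by rewrite !mulr_ge0.
  move=> a b az bz; have [B1 D1 T1] := H1 a b az bz; have [B2 D2 T2] := H2 a b az bz.
  have h2 := dist _ _ az bz; have h0 : 0 <= `|b - a| by [].
  have K0 : 0 <= K1 * K2 by exact: mulr_ge0.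
  rewrite polyfun_derive_mul //.
  move: B1 B2 D1 D2 T1 T2; set F := f1 b; set G := f2 b; set F' := 'D_(b - a) f1 b.
  set G' := 'D_(b - a) f2 b; set h := `|b - a| => B1 B2 D1 D2 T1 T2.
  set r1 := (F - f1 a - F') in T1; set r2 := (G - f2 a - G') in T2.
  split.
  + rewrite normrM (le_trans (ler_pM _ _ B1 B2)) //; lra.
  + rewrite (le_trans (ler_normD _ _)) // !normrM.
    have := ler_pM (normr_ge0 _) (normr_ge0 _) B1 D2.
    have := ler_pM (normr_ge0 _) (normr_ge0 _) B2 D1.
    have : 0 <= K1 * K2 * h by rewrite mulr_ge0.
    lra.
  (* Here F' + r1 and G' + r2 are the full increments of f1 and f2, so the last product is of second
     order in h. *)
  + rewrite (_ : _ - _ - _ = F * r2 + r1 * G - (F' + r1) * (G' + r2)); last first.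
      by rewrite /r1 /r2; ring.
    have e1 : `|F' + r1| <= 3 * K1 * h.
      rewrite (le_trans (ler_normD _ _)) // (le_trans (lerD D1 T1)) //.
      have : K1 * h * h <= K1 * h * 2 by rewrite ler_wpM2l ?mulr_ge0.
      rewrite expr2; lra.
    have e2 : `|G' + r2| <= 3 * K2 * h.
      rewrite (le_trans (ler_normD _ _)) // (le_trans (lerD D2 T2)) //.
      have : K2 * h * h <= K2 * h * 2 by rewrite ler_wpM2l ?mulr_ge0.
      rewrite expr2; lra.
    rewrite (le_trans (ler_normB _ _)) //.
    have e3 := ler_normD (F * r2) (r1 * G).
    have := ler_pM (normr_ge0 _) (normr_ge0 _) e1 e2.
    have := ler_pM (normr_ge0 _) (normr_ge0 _) B1 T2.
    have := ler_pM (normr_ge0 _) (normr_ge0 _) T1 B2.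
    move: e3; rewrite !normrM => e3.
    rewrite !expr2; lra.
Qed.

(** * Polynomial maps: Jacobians and uniform Taylor bounds *)

Definition polymap (R : realType) k l (G : 'rV[R]_k -> 'rV[R]_l) :=
  forall j, polyfun (fun x => G x 0 j).

Lemma polymap_differentiable (R : realType) k l (G : 'rV[R]_k -> 'rV[R]_l) x :
  polymap G -> differentiable G x.
Proof.
move=> pG.
have -> : G = \sum_j (fun y => G y 0 j *: delta_mx 0 j).
  apply/funext => y; rewrite fct_sumE; exact: row_sum_delta.
apply: differentiable_sum => j; apply: differentiableZl.
exact: polyfun_differentiable.
Qed.

Lemma polymap_jacobianE (R : realType) k l (G : 'rV[R]_k -> 'rV[R]_l) x v j :
  polymap G -> (v *m 'J G x) 0 j = 'D_v (fun y => G y 0 j) x.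
Proof.
move=> pG; have dG := polymap_differentiable x pG.
by rewrite -deriveEjacobian // derive_mx ?mxE //; exact: diff_derivable.
Qed.

Lemma polymap_jacobian_entry (R : realType) k l (G : 'rV[R]_k -> 'rV[R]_l) x i j :
  polymap G -> 'J G x i j = 'D_(delta_mx 0 i) (fun y => G y 0 j) x.
Proof. by move=> pG; rewrite -polymap_jacobianE // -rowE [RHS]mxE. Qed.

(** The sum of the individual nonnegative constants dominates each of them, and monotonicity does
    the rest. *)
Lemma ex_uniform_bound (R : realType) (I : finType) (P : I -> R -> Prop) :
  (forall i K K', K <= K' -> P i K -> P i K') ->
  (forall i, exists2 K, 0 <= K & P i K) ->
  exists2 K, 0 <= K & forall i, P i K.
Proof.
move=> mono bP; have H i := cid2 (bP i).
  exists (\sum_i s2val (H i)).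
  by apply: sumr_ge0 => i _; case: (H i).
move=> i; apply: (mono i (s2val (H i))); last by case: (H i).
by rewrite (bigD1 i) //= lerDl sumr_ge0 // => j _; case: (H j).
Qed.

(** The remainder bound is the scalar estimate for the components of G; the two Jacobian bounds are
    the scalar estimate for their partial derivatives. Having [1 <= K] lets later estimates round up
    to higher powers of K. *)
Lemma polymap_taylor (R : realType) k (G : 'rV[R]_k -> 'rV[R]_k) (z0 : 'rV[R]_k) :
  polymap G ->
  exists2 K, 1 <= K & forall a b, `|a - z0| <= 1 -> `|b - z0| <= 1 ->
  [/\ `|'J G b| <= K, `|'J G b - 'J G a| <= K * `|b - a| &
      `|G b - G a - (b - a) *m 'J G b| <= K * `|b - a| ^+ 2].
Proof.
move=> pG.
(* Abstracting ['J G] keeps unification from unfolding differentials at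
   different points. *)
have [JG [JGE JGv JGij]] : exists JG : 'rV[R]_k -> 'M[R]_k,
    [/\ forall x, 'J G x = JG x,
        forall x v j, (v *m JG x) 0 j = 'D_v (fun y => G y 0 j) x &
        forall x i j, JG x i j = 'D_(delta_mx 0 i) (fun y => G y 0 j) x].
  exists (fun x => 'J G x); split => // x v j; first exact: polymap_jacobianE.
  exact: polymap_jacobian_entry.
have [K1 K10 H1] : exists2 K, 0 <= K & forall j : 'I_k, forall a b,
    `|a - z0| <= 1 -> `|b - z0| <= 1 ->
    `|G b 0 j - G a 0 j - ((b - a) *m JG b) 0 j| <= K * `|b - a| ^+ 2.
  apply: ex_uniform_bound => [j K K' KK' H a b az bz|j].
    by rewrite (le_trans (H a b az bz)) // ler_wpM2r ?sqr_ge0.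
  have [K K0 H] := polyfun_taylor z0 (pG j); exists K => // a b az bz.
  by rewrite JGv; case: (H a b az bz).
have [K2 K20 H2] : exists2 K, 0 <= K & forall ij : 'I_k * 'I_k, forall a b,
    `|a - z0| <= 1 -> `|b - z0| <= 1 ->
    `|JG b ij.1 ij.2| <= K /\
    `|JG b ij.1 ij.2 - JG a ij.1 ij.2| <= K * `|b - a|.
  apply: ex_uniform_bound => [ij K K' KK' H a b az bz|[i j]].
    have [h1 h2] := H a b az bz; split; first exact: le_trans KK'.
    by rewrite (le_trans h2) // ler_wpM2r.
  have [K K0 H] := polyfun_taylor z0 (polyfun_derive (delta_mx 0 i) (pG j)).
  (* The first K bounds the entry itself; K + 2 K bounds its increment, as the remainder K |b - a|^2
     is at most 2 K |b - a|. *)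
  exists (K + (K + K * 2)); first by rewrite !addr_ge0 ?mulr_ge0.
  move=> a b az bz; rewrite -[(i, j).1]/i -[(i, j).2]/j.
  rewrite !JGij.
  have [h1 h2 h3] := H a b az bz; split.
    by rewrite (le_trans h1) // lerDl addr_ge0 ?mulr_ge0.
  have ab : `|b - a| <= 2.
    rewrite -(subrKA z0) (le_trans (ler_normD _ _)) //.
    by rewrite [`|z0 - a|]distrC (_ : 2 = 1 + 1) ?lerD.
  rewrite -[X in `|X|](subrK ('D_(b - a) ('D_(delta_mx 0 i) (fun y => G y 0 j)) b)).
  rewrite (le_trans (ler_normD _ _)) // (le_trans (lerD h3 h2)) //.
  have : K * `|b - a| * `|b - a| <= K * `|b - a| * 2 by rewrite ler_wpM2l ?mulr_ge0.
  have : 0 <= K * `|b - a| by rewrite mulr_ge0.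
  rewrite expr2; lra.
exists (1 + K1 + K2); first by rewrite -addrA lerDl addr_ge0.
move=> a b az bz; have [Eb Ea] := (JGE b, JGE a); rewrite Eb Ea.
split; apply: mx_norm_le => [|i j].
- by rewrite !addr_ge0.
- have [h _] := H2 (i, j) a b az bz; rewrite (le_trans h) //; lra.
- by rewrite mulr_ge0 ?addr_ge0.
- have [_ h] := H2 (i, j) a b az bz.
  rewrite /= in h; rewrite !mxE (le_trans h) // ler_wpM2r //; lra.
- by rewrite mulr_ge0 ?addr_ge0 ?sqr_ge0.
- rewrite ord1; have := H1 j a b az bz.
  move: ((b - a) *m _) => u h; rewrite !mxE (le_trans h) // ler_wpM2r ?sqr_ge0 //; lra.
Qed.

(** * One Levenberg-Marquardt step *)

Lemma ler_norm_mulmxS (R : realType) m n p (A : 'M[R]_(m, n)) (B : 'M[R]_(n, p)) :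
  `|A *m B| <= n.+1%:R * (`|A| * `|B|).
Proof.
by rewrite (le_trans (ler_norm_mulmx A B)) // ler_wpM2r ?mulr_ge0 // ler_nat.
Qed.

Lemma gram_lipschitz (R : realType) k (A B : 'M[R]_k) K :
  `|A| <= K -> `|B| <= K ->
  `|A *m A^T - B *m B^T| <= 2 * (k.+1%:R * (K * `|A - B|)).
Proof.
move=> AK BK.
have -> : A *m A^T - B *m B^T = (A - B) *m A^T + B *m (A - B)^T.
  by rewrite linearB /= mulmxBl mulmxBr subrKA.
rewrite (le_trans (ler_normD _ _)) // (_ : 2 = 1 + 1) // mulrDl mul1r.
rewrite lerD // (le_trans (ler_norm_mulmxS _ _)) // ler_wpM2l // mx_norm_tr.
  by rewrite mulrC ler_wpM2r.
by rewrite ler_wpM2r.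
Qed.

(** Pairing v A A^T with v gives the squared Euclidean norm of v A. *)
Lemma mulmx_gram_eq0 (R : realType) k (A : 'M[R]_k) (v : 'rV[R]_k) :
  v *m (A *m A^T) = 0 -> v *m A = 0.
Proof.
move=> vA0; apply/eqP; rewrite -dot_eq0 /dot trmx_mul mulmxA -[_ *m A^T]mulmxA vA0.
by rewrite mul0mx mxE.
Qed.

Lemma le0_of_small_multiples (R : realType) (x c s0 : R) :
  0 < s0 -> 0 <= c -> (forall s, 0 < s -> s <= s0 -> x <= s * c) -> x <= 0.
Proof.
move=> s00 c0 H; rewrite leNgt; apply/negP => x0.
have cx : 0 < c + x by rewrite ltr_wpDl.
(* The choice s = x / (c + x), capped by s0, makes s c < x; the extra x in the denominator covers c
   = 0. *)
have [le1|lt1] := lerP s0 (x / (c + x)).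
  have := H s0 s00 (lexx _); rewrite leNgt => /negP; apply.
  rewrite (le_lt_trans (_ : _ <= x / (c + x) * c)) ?ler_wpM2r //.
  by rewrite mulrAC ltr_pdivrMr // ltr_pM2l // ltrDl.
have := H _ (divr_gt0 x0 cx) (ltW lt1); rewrite leNgt => /negP; apply.
by rewrite mulrAC ltr_pdivrMr // ltr_pM2l // ltrDl.
Qed.

(** The conclusion of [polymap_taylor] with an arbitrary matrix function in place of the Jacobian,
    so that the analysis of a step is pure linear algebra and inequalities. *)
Definition taylor_near (R : realType) k (g : 'rV[R]_k -> 'rV[R]_k)
    (J : 'rV[R]_k -> 'M[R]_k) (z0 : 'rV[R]_k) (K : R) :=
  forall a b, `|a - z0| <= 1 -> `|b - z0| <= 1 ->
  [/\ `|J b| <= K, `|J b - J a| <= K * `|b - a| &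
      `|g b - g a - (b - a) *m J b| <= K * `|b - a| ^+ 2].

(** Both z0 + u and z0 + u - s v are zeros of g, so Taylor's formula gives s |v J(z0 + u)| <= K s^2
    |v|^2; divide by s and let s tend to 0. *)
Lemma ker_along_zeros (R : realType) k (g : 'rV[R]_k -> 'rV[R]_k)
    (J : 'rV[R]_k -> 'M[R]_k) (z0 u v : 'rV[R]_k) (K : R) :
  taylor_near g J z0 K ->
  (forall y, y *m J z0 = 0 -> g (z0 + y) = 0) ->
  u *m J z0 = 0 -> `|u| <= 1 / 2 -> v *m J z0 = 0 -> v *m J (z0 + u) = 0.
Proof.
move=> gT gker uJ u1 vJ.
have K0 : 0 <= K.
  have [] := gT z0 z0; rewrite ?subrr ?normr0 // => + _ _; exact: le_trans.
apply/eqP; rewrite -normr_le0.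
have v0 : 0 <= `|v| by [].
have d0 : 0 < 2 * (`|v| + 1) by rewrite mulr_gt0 // ltr_wpDl.
(* This cap on s gives s |v| <= 1/2, which together with |u| <= 1/2 keeps both points in the unit
   ball around z0. *)
apply: (@le0_of_small_multiples _ _ (K * `|v| ^+ 2) (1 / (2 * (`|v| + 1)))).
- exact: divr_gt0.
- by rewrite mulr_ge0 ?sqr_ge0.
move=> s s0; rewrite ler_pdivlMr // => sv.
have nb : `|z0 + u - z0| <= 1 by rewrite addrAC subrr add0r; lra.
have na : `|z0 + (u - s *: v) - z0| <= 1.
  rewrite addrAC subrr add0r (le_trans (ler_normB _ _)) // normrZ gtr0_norm //; lra.
have [_ _] := gT _ _ na nb.
rewrite !gker //; last by rewrite mulmxBl -scalemxAl uJ vJ scaler0 subrr.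
have -> : z0 + u - (z0 + (u - s *: v)) = s *: v.
  by rewrite opprD addrACA subrr add0r opprB addrC subrK.
rewrite subrr sub0r normrN -scalemxAl !normrZ gtr0_norm // exprMn.
by rewrite expr2 -!mulrA [K * _]mulrCA ler_pM2l // mulrCA.
Qed.

(** P = M X with M = A A^T and X a generalized inverse. From M X M = M, P is idempotent and v - v P
    lies in the left kernel of M, which is that of A; and v P = (v M) X is controlled by v M. *)
Lemma gram_projection (R : realType) k (A : 'M[R]_k) :
  exists P : 'M[R]_k, exists2 c : R, 1 <= c &
  [/\ forall v : 'rV[R]_k, (v - v *m P) *m A = 0, P *m P = P,
      forall v : 'rV[R]_k, `|v *m P| <= c * `|v| &
      forall v : 'rV[R]_k, `|v *m P| <= c * `|v *m (A *m A^T)|].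
Proof.
set M := A *m A^T; pose X := pinvmx M; pose N : R := k.+1%:R.
have N0 : 0 <= N by [].
have MXM : M *m X *m M = M by exact: mulmxKpV.
exists (M *m X), (1 + N * `|M *m X| + N * `|X|).
  by rewrite -addrA lerDl addr_ge0 ?mulr_ge0.
split=> [v||v|v].
- by apply: mulmx_gram_eq0; rewrite -/M mulmxBl -(mulmxA v _ M) MXM subrr.
- by rewrite mulmxA MXM.
- rewrite (le_trans (ler_norm_mulmxS _ _)) // mulrCA mulrC ler_wpM2r //.
  by rewrite -/N addrAC lerDr addr_ge0 ?mulr_ge0.
- rewrite mulmxA (le_trans (ler_norm_mulmxS _ _)) // mulrCA mulrC ler_wpM2r //.
  by rewrite -/N lerDr addr_ge0 ?mulr_ge0.
Qed.

(** By [ker_along_zeros], v - v P is still annihilated at z0 + u, so v may be replaced by y = v P.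
    For y the coercivity at z0 survives, because the Gram matrix moves only by O(|u|). *)
Lemma gram_coercive_near (R : realType) k (g : 'rV[R]_k -> 'rV[R]_k)
    (J : 'rV[R]_k -> 'M[R]_k) (z0 u v : 'rV[R]_k) (P : 'M[R]_k) (K c : R) :
  1 <= K -> 1 <= c -> taylor_near g J z0 K ->
  (forall y, y *m J z0 = 0 -> g (z0 + y) = 0) ->
  (forall y : 'rV[R]_k, (y - y *m P) *m J z0 = 0) -> P *m P = P ->
  (forall y : 'rV[R]_k, `|y *m P| <= c * `|y *m (J z0 *m (J z0)^T)|) ->
  u *m J z0 = 0 -> 4 * c * k.+1%:R ^+ 2 * K ^+ 2 * `|u| <= 1 ->
  `|v *m P| <= 2 * c * `|v *m (J (z0 + u) *m (J (z0 + u))^T)|.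
Proof.
move=> K1 c1 gT gker PJ PP cP uJ ule.
set N : R := k.+1%:R in ule; have N1 : 1 <= N by rewrite ler1n.
have u0 : 0 <= `|u| by [].
have CNK : 1 <= c * N ^+ 2 * K ^+ 2.
  by rewrite !mulr_ege1 ?exprn_ege1.
have ule' : `|u| <= 1 / 4 by have := ler_wpM2r u0 CNK; lra.
have nb : `|z0 + u - z0| <= 1 by rewrite addrAC subrr add0r; lra.
have n0 : `|z0 - z0| <= 1 by rewrite subrr normr0.
have [J0K] := gT _ _ n0 n0.
have [JbK Jb0 _] := gT z0 _ n0 nb.
move=> _ _; rewrite addrAC subrr add0r in Jb0.
set Jb := J (z0 + u) in JbK Jb0 *.
set y := v *m P.
have yE : v *m (Jb *m Jb^T) = y *m (Jb *m Jb^T).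
  apply/eqP; rewrite -subr_eq0 -mulmxBl mulmxA.
  rewrite (ker_along_zeros gT gker uJ _ (PJ v)) ?mul0mx //; lra.
have yP : y *m P = y by rewrite /y -mulmxA PP.
rewrite yE; have := cP y; rewrite yP.
set Mb := Jb *m Jb^T; set M := J z0 *m _.
have -> : y *m M = y *m Mb + y *m (M - Mb) by rewrite -mulmxDr addrC subrK.
move=> le1.
have dM : `|M - Mb| <= 2 * (N * (K * (K * `|u|))).
  rewrite (le_trans (gram_lipschitz J0K JbK)) // distrC ler_wpM2l //.
  by rewrite ler_wpM2l // ler_wpM2l // (le_trans _ K1).
have le2 : `|y *m (M - Mb)| <= N * (`|y| * (2 * (N * (K * (K * `|u|))))).
  by rewrite (le_trans (ler_norm_mulmxS _ _)) // ler_wpM2l // ler_wpM2l.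
(* The hypothesis on |u| makes the second summand at most |y| / 2, so it can be absorbed on the
   left. *)
have le3 : `|y| <= c * (`|y *m Mb| + N * (`|y| * (2 * (N * (K * (K * `|u|)))))).
  rewrite (le_trans le1) // ler_wpM2l ?(le_trans _ c1) //.
  by rewrite (le_trans (ler_normD _ _)) // lerD2l.
have := ler_wpM2r (normr_ge0 y) ule.
rewrite !expr2; lra.
Qed.

Lemma LM_step_estimate (R : realType) k (g : 'rV[R]_k -> 'rV[R]_k)
    (J : 'rV[R]_k -> 'M[R]_k) (z0 : 'rV[R]_k) (K : R) :
  1 <= K -> taylor_near g J z0 K ->
  (forall y, y *m J z0 = 0 -> g (z0 + y) = 0) ->
  exists P : 'M[R]_k, exists2 C : R, 1 <= C & exists2 rho : R, 0 < rho &
  [/\ forall y : 'rV[R]_k, (y - y *m P) *m J z0 = 0,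
      forall y : 'rV[R]_k, `|y *m P| <= C * `|y| &
      forall z dz, `|z - z0| <= rho -> (g z = 0 -> dz = 0) ->
        (g z <> 0 -> dz *m (J z *m (J z)^T + (norm2 (g z))%:M) = - (g z *m (J z)^T)) ->
        `|dz| <= C * `|(z - z0) *m P| /\
        `|(z + dz - z0) *m P| <= C * `|(z - z0) *m P| ^+ 2].
Proof.
move=> K1 gT gker.
have [P [c c1 [PJ PP Pc PM]]] := gram_projection (J z0).
pose N : R := k.+1%:R; have N1 : 1 <= N by rewrite ler1n.
have [c0 K0 N0] : [/\ 0 <= c, 0 <= K & 0 <= N].
  by rewrite (le_trans _ c1) // (le_trans _ K1).
(* In terms of e and w of the overview: c2 gives |e| <= c2 |g z|, c3 gives |w| <= c3 |e|, and c4, c5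
   bound w times the Gram matrix at z and at the nearby zero [zb] by multiples of |e|^2. *)
pose c2 := 2 * (2 * c * N * K).
pose c3 := c2 * (N * (3 * N ^+ 2 * K ^+ 2)).
pose c4 := 3 * N ^+ 2 * K ^+ 2 + 2 * N ^+ 2 * K * c3.
pose c5 := c4 + 2 * N ^+ 2 * K ^+ 2 * c3.
have c20 : 0 <= c2 by rewrite /c2 !mulr_ge0.
have c30 : 0 <= c3 by rewrite /c3 !mulr_ge0 // exprn_ge0.
have c40 : 0 <= c4 by rewrite /c4 addr_ge0 // !mulr_ge0 // exprn_ge0.
have c50 : 0 <= c5 by rewrite /c5 addr_ge0 // !mulr_ge0 // exprn_ge0.
(* Both e and d - e have norm at most (1 + c) |d|, so |d| <= 1 / D meets the smallness condition of
   [gram_coercive_near] for u = d - e. *)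
pose D := 4 * c * N ^+ 2 * K ^+ 2 * (1 + c).
have N2 : 1 <= N ^+ 2 by rewrite exprn_ege1.
have K2 : 1 <= K ^+ 2 by rewrite exprn_ege1.
have CNK : 1 <= c * N ^+ 2 * K ^+ 2 by rewrite !mulr_ege1.
have D0 : 0 < D.
  by have := ler_wpM2r (addr_ge0 ler01 c0) CNK; rewrite mul1r /D; lra.
exists P, (1 + c + c3 + 2 * c * c5).
  by rewrite -!addrA lerDl !addr_ge0 // !mulr_ge0.
exists D^-1; first by rewrite invr_gt0.
split=> // [y|z dz zr dz0 dzE].
  by rewrite (le_trans (Pc y)) // ler_wpM2r //; have := mulr_ge0 c0 c50; lra.
set d := z - z0 in zr *; set e := d *m P.
have dD : D * `|d| <= 1 by rewrite -ler_pdivlMl // mulr1.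
have d0 : 0 <= `|d| by [].
have eB : `|e| <= (1 + c) * `|d| by rewrite (le_trans (Pc d)) // ler_wpM2r // lerDr.
have uB : `|d - e| <= (1 + c) * `|d|.
  by rewrite (le_trans (ler_normB _ _)) // mulrDl mul1r lerD2l Pc.
have Bd : 4 * ((1 + c) * `|d|) <= 1.
  have : 0 <= (1 + c) * `|d| by rewrite mulr_ge0 // addr_ge0.
  move/ler_wpM2r => /(_ _ _ CNK); move: dD; rewrite /D; lra.
have Bd' : 4 * c * N ^+ 2 * K ^+ 2 * ((1 + c) * `|d|) <= 1.
  by rewrite mulrA.
pose zb := z0 + (d - e).
have zbE : z - zb = e.
  by rewrite /zb /d addrA [z0 + _]addrC subrK opprB addrCA subrr addr0.
have uJ : (d - e) *m J z0 = 0 by exact: PJ.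
have gzb : g zb = 0 by exact: gker.
have coer (v : 'rV[R]_k) : `|v *m P| <= 2 * c * `|v *m (J zb *m (J zb)^T)|.
  apply: (@gram_coercive_near _ _ g J z0 (d - e) v P K c) => //.
  apply: le_trans Bd'; rewrite ler_wpM2l // !mulr_ge0 // exprn_ge0 //.
have nzb : `|zb - z0| <= 1 by rewrite /zb addrAC subrr add0r; lra.
have nz : `|z - z0| <= 1 by rewrite -/d; have := mulr_ge0 c0 d0; lra.
have [JzK JzJb T1] := gT _ _ nzb nz.
have [JbK _ T2] := gT _ _ nz nzb.
move: JzJb T1 T2; rewrite -[zb - z]opprB zbE gzb normrN mulNmx subr0 sub0r opprK.
move=> JzJb T1 T2.
have e0 : 0 <= `|e| by [].
have e1 : `|e| <= 1 / 4 by lra.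
have eP : e *m P = e by rewrite /e -mulmxA PP.
have eJb : `|e| <= 2 * c * N * K * `|e *m J zb|.
  have := coer e; rewrite eP mulmxA => /le_trans; apply.
  rewrite -!mulrA ler_wpM2l // ler_wpM2l // (le_trans (ler_norm_mulmxS _ _)) //.
  by rewrite ler_wpM2l // mulrC mx_norm_tr ler_wpM2r.
have ee : `|e| * `|e| <= `|e| by rewrite ler_piMl //; lra.
have eJz : `|e *m J z| <= N * K * `|e|.
  rewrite (le_trans (ler_norm_mulmxS _ _)) // -mulrA ler_wpM2l //.
  by rewrite mulrC ler_wpM2r.
have gub : `|g z| <= 2 * N * K * `|e|.
  have := ler_normD (e *m J z) (g z - e *m J z); rewrite addrC subrK => le1.
  have le2 : K * (`|e| * `|e|) <= K * `|e| by rewrite ler_wpM2l.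
  have := ler_wpM2r (mulr_ge0 K0 e0) N1.
  by move: T1 eJz; rewrite expr2; lra.
(* Error bound: coercivity gives |e| <= 2 c N K (|g z| + K |e|^2), and the quadratic term is at most
   |e| / 2 since e is small. *)
have elb : `|e| <= c2 * `|g z|.
  have le1 : `|e *m J zb| <= `|g z| + K * (`|e| * `|e|).
    rewrite -expr2 -[e *m J zb](addKr (- g z)) opprK (le_trans (ler_normD _ _)) //.
    by rewrite lerD2l.
  have a0 : 0 <= 2 * c * N * K by rewrite !mulr_ge0.
  have := le_trans eJb (ler_wpM2l a0 le1).
  have le2 : 2 * (2 * c * N * K * K * `|e|) <= 1.
    have NN : N <= N ^+ 2 by rewrite expr2 ler_peMr.
    have le3 : c * N * K ^+ 2 <= c * N ^+ 2 * K ^+ 2.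
      by rewrite ler_wpM2r ?sqr_ge0 // ler_wpM2l.
    have c0' : 0 <= c * N * K ^+ 2 by rewrite !mulr_ge0 // sqr_ge0.
    by have := ler_pM c0' e0 le3 eB; move: Bd'; rewrite [K ^+ 2]expr2; lra.
  have := ler_wpM2r e0 le2; rewrite /c2; lra.
(* At a zero of g the error bound forces e = 0 and the iteration stays put. *)
have [gz0|/eqP gz0] := eqVneq (g z) 0.
  have e00 : e = 0.
    by apply/eqP; rewrite -normr_le0 (le_trans elb) // gz0 normr0 mulr0.
  by rewrite dz0 // addr0 -/d -/e e00 !normr0 expr0n !mulr0.
set nu := norm2 (g z) in dzE.
have nu0 : 0 < nu by rewrite norm2_gt0; apply/eqP.
have nulb : `|e| <= c2 * nu by rewrite (le_trans elb) // ler_wpM2l // ler_norm_norm2.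
have nuub : nu <= 2 * N ^+ 2 * K * `|e|.
  rewrite (le_trans (ler_norm2_norm _)) // -/N expr2.
  by have := ler_wpM2l N0 gub; lra.
pose w := e + dz; pose q := nu *: e + (e *m J z - g z) *m (J z)^T.
have wq : w *m (J z *m (J z)^T + nu%:M) = q.
  rewrite mulmxDl dzE // mulmxDr mul_mx_scalar /q mulmxBl mulmxA.
  by rewrite [RHS]addrA [nu *: e + _]addrC.
have qB : `|q| <= 3 * N ^+ 2 * K ^+ 2 * `|e| ^+ 2.
  rewrite (le_trans (ler_normD _ _)) // normrZ gtr0_norm //.
  have le1 : `|(e *m J z - g z) *m (J z)^T| <= N * (K * `|e| ^+ 2 * K).
    rewrite (le_trans (ler_norm_mulmxS _ _)) // ler_wpM2l //.
    by rewrite ler_pM // ?mx_norm_tr // distrC.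
  have le2 := ler_wpM2r e0 nuub.
  have p1 : N ^+ 2 * K * `|e| ^+ 2 <= N ^+ 2 * K ^+ 2 * `|e| ^+ 2.
    by rewrite ler_wpM2r ?sqr_ge0 // ler_wpM2l ?sqr_ge0 // expr2 ler_peMr.
  have p2 : N * (K ^+ 2 * `|e| ^+ 2) <= N ^+ 2 * (K ^+ 2 * `|e| ^+ 2).
    by rewrite ler_wpM2r ?mulr_ge0 ?sqr_ge0 // expr2 ler_peMr.
  move: le1 le2 p1 p2; rewrite !expr2; lra.
have wB : `|w| <= c3 * `|e|.
  have le1 : nu * `|w| <= N * (3 * N ^+ 2 * K ^+ 2 * `|e| ^+ 2).
    rewrite (le_trans (LM_resolvent_bound nu0 wq)) //.
    by rewrite ler_pM // ler_nat.
  (* The bound on w comes from cancelling |e|; when e = 0, positivity of nu gives w = 0 directly. *)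
  have [ez|en0] := eqVneq e 0.
    move: le1; rewrite ez normr0 expr0n /= !mulr0 => le1.
    by rewrite -(ler_pM2l nu0) mulr0.
  have ep : 0 < `|e| by rewrite normr_gt0.
  rewrite -(ler_pM2l ep) (le_trans (ler_wpM2r (normr_ge0 w) nulb)) //.
  rewrite -mulrA (le_trans (ler_wpM2l c20 le1)) //.
  by rewrite /c3 le_eqVlt; apply/orP; left; apply/eqP; ring.
have wJ : `|w *m (J z *m (J z)^T)| <= c4 * `|e| ^+ 2.
  have -> : w *m (J z *m (J z)^T) = q - nu *: w.
    by rewrite -wq mulmxDr mul_mx_scalar addrK.
  rewrite (le_trans (ler_normB _ _)) // /c4 mulrDl lerD // normrZ gtr0_norm //.
  rewrite (le_trans (ler_pM (ltW nu0) (normr_ge0 _) nuub wB)) //.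
  by rewrite le_eqVlt; apply/orP; left; apply/eqP; ring.
(* Coercivity is available at [zb], not at z; exchanging the Gram matrices costs O(|e|) |w| =
   O(|e|^2). *)
have wJb : `|w *m (J zb *m (J zb)^T)| <= c5 * `|e| ^+ 2.
  rewrite -[J zb *m (J zb)^T](subrK (J z *m (J z)^T)) mulmxDr addrC.
  rewrite (le_trans (ler_normD _ _)) // /c5 mulrDl lerD //.
  rewrite (le_trans (ler_norm_mulmxS _ _)) // -/N.
  have le2 : `|J zb *m (J zb)^T - J z *m (J z)^T| <= 2 * (N * (K * (K * `|e|))).
    rewrite (le_trans (gram_lipschitz JbK JzK)) // ler_wpM2l // ler_wpM2l //.
    by rewrite ler_wpM2l // distrC.
  have le3 : N * (`|w| * `|J zb *m (J zb)^T - J z *m (J z)^T|) <=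
      N * (c3 * `|e| * (2 * (N * (K * (K * `|e|))))).
    by rewrite ler_wpM2l // ler_pM.
  rewrite (le_trans le3) // le_eqVlt; apply/orP; left; apply/eqP; ring.
split.
  have -> : dz = w - e by rewrite /w addrC addKr.
  rewrite (le_trans (ler_normB _ _)) // (le_trans (lerD wB (lexx _))) //.
  have : 0 <= 2 * c * c5 * `|e| by rewrite !mulr_ge0.
  have : 0 <= c * `|e| by rewrite mulr_ge0.
  lra.
have -> : (z + dz - z0) *m P = w *m P.
  by rewrite addrAC -/d mulmxDl -/e /w mulmxDl eP.
rewrite (le_trans (coer w)) // (le_trans (ler_wpM2l _ wJb)) ?mulr_ge0 //.
rewrite mulrA ler_wpM2r ?sqr_ge0 //; lra.
Qed.

(** * Quadratic convergence *)

Lemma cvg_mul_to0 (R : realType) (c : R) (u : nat -> R) :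
  u @ \oo --> (0 : R) -> (fun i => c * u i) @ \oo --> (0 : R).
Proof.
move=> u0; have : c * u i @[i --> \oo] --> c * 0 by apply: cvgM => //; exact: cvg_cst.
by rewrite mulr0.
Qed.

(* The sum of [`|z i - z0|] and [2 * C * a i] is nonincreasing, which keeps the
   sequence in the ball of radius [rho]. *)
Lemma quadratic_decay_cvg (R : realType) k (z : nat -> 'rV[R]_k) (z0 : 'rV[R]_k)
    (a : nat -> R) (C rho r : R) :
  1 <= C -> r <= 1 / (2 * C ^+ 2) -> r <= rho / (3 * C ^+ 2) ->
  `|z 0%N - z0| <= r -> a 0%N <= C * `|z 0%N - z0| ->
  (forall i, 0 <= a i) ->
  (forall i, `|z i - z0| <= rho ->
     `|z i.+1 - z i| <= C * a i /\ a i.+1 <= C * a i ^+ 2) ->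
  exists zh : 'rV[R]_k, [/\ z @ \oo --> zh, a @ \oo --> (0 : R),
    forall i, `|z i - zh| <= 2 * C * a i & forall i, a i.+1 <= C * a i ^+ 2].
Proof.
move=> C1 r1 r2 zr a0 apos step.
have C0 : 0 < C by exact: lt_le_trans C1.
have C2 : 1 <= C ^+ 2 by rewrite exprn_ege1.
move: r1 r2; rewrite !ler_pdivlMr ?mulr_gt0 ?exprn_gt0 // => r1 r2.
(* The first bound makes a halve at each step, the second is the ball invariant. Initially 2 C a 0
   <= 2 C^2 r <= 1 and r + 2 C^2 r <= 3 C^2 r <= rho. *)
have inv i : [/\ 2 * (C * a i) <= 1 & `|z i - z0| + 2 * (C * a i) <= rho].
  have CC : C * (C * `|z 0%N - z0|) <= C ^+ 2 * r.
    by rewrite mulrA -expr2 ler_wpM2l // ltW // exprn_gt0.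
  have rr : r <= C ^+ 2 * r by rewrite ler_peMl // (le_trans _ zr).
  elim: i => [|i [ih1 ih2]].
    by have := ler_wpM2l (ltW C0) a0; split; lra.
  have [|s1 s2] := step i; first by have := mulr_ge0 (ltW C0) (apos i); lra.
  have le1 : 2 * (C * a i.+1) <= C * a i.
    have := ler_wpM2l (ltW C0) s2.
    by have := ler_wpM2r (mulr_ge0 (ltW C0) (apos i)) ih1; rewrite expr2; lra.
  have := mulr_ge0 (ltW C0) (apos i.+1); have := mulr_ge0 (ltW C0) (apos i).
  have := ler_normD (z i.+1 - z i) (z i - z0); rewrite subrKA.
  by split; lra.
have st i : `|z i.+1 - z i| <= C * a i /\ a i.+1 <= C * a i ^+ 2.
  by apply: step; have [_] := inv i; have := mulr_ge0 (ltW C0) (apos i); lra.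
have half i : 2 * a i.+1 <= a i.
  have [h _] := inv i; have [_ s] := st i.
  by have := ler_wpM2r (apos i) h; move: s; rewrite expr2; lra.
(* Since a at least halves, all later movement is at most 2 C a i; this yields both the Cauchy
   property and the distance to the limit. *)
have tail i n : `|z (i + n)%N - z i| + 2 * (C * a (i + n)%N) <= 2 * (C * a i).
  elim: n => [|n ih]; first by rewrite addn0 subrr normr0 add0r.
  rewrite addnS.
  have [s _] := st (i + n)%N; have h := ler_wpM2l (ltW C0) (half (i + n)%N).
  have := ler_normD (z (i + n).+1 - z (i + n)%N) (z (i + n)%N - z i); rewrite subrKA.
  lra.
have tail' i n : `|z (i + n)%N - z i| <= 2 * (C * a i).
  by have := tail i n; have := mulr_ge0 (ltW C0) (apos (i + n)%N); lra.
have ageo i : a i <= a 0%N * 2^-1 ^+ i.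
  elim: i => [|i ih]; first by rewrite expr0 mulr1.
  by rewrite exprSr mulrA ler_pdivlMr // mulrC (le_trans (half i)).
have acvg : a @ \oo --> (0 : R).
  apply: (@squeeze_cvgr _ _ _ _ (fun=> 0) (fun i => a 0%N * 2^-1 ^+ i)).
  - by near=> i; rewrite apos ageo.
  - exact: cvg_cst.
  - by apply/cvg_mul_to0/cvg_expr; rewrite ger0_norm ?invf_lt1 // ltr1n.
have Cacvg : (fun i => 2 * (C * a i)) @ \oo --> (0 : R).
  by do 2!apply: cvg_mul_to0.
have zc : cvg (z @ \oo).
  apply/cauchy_cvgP; apply: cauchy_exP => e e0.
  have [i _ Hi] := cvgr_lt _ Cacvg _ e0.
  exists (z i); exists i => // j /= ij.
  rewrite -ball_normE /= distrC -(subnKC ij) (le_lt_trans (tail' _ _)) //.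
  exact: (Hi i (leqnn i)).
exists (lim (z @ \oo)); split=> // [i|i]; last by case: (st i).
apply/ler_addgt0Pr => e e0.
have [j _ Hj] := (cvgrPdist_le _ _).1 zc _ e0.
rewrite distrC -(subrKA (z (i + j)%N)) (le_trans (ler_normD _ _)) // addrC lerD //.
  by rewrite -mulrA tail'.
exact: (Hj _ (leq_addl i j)).
Unshelve. all: by end_near.
Qed.

(** With a i = |(z i - z0) P|, the distance to the limit is at most 2 C a i. Conversely, once the
    limit is known to lie in z0 + ker J(z0), a i is at most C times that distance, so the quadratic
    decay of a passes to the distances. *)
Theorem LM_local_quadratic_convergence (R : realType) k (f : 'rV[R]_k -> R)
    (z0 : 'rV[R]_k) :
  polymap (gradient f) ->
  (forall y, y *m 'J (gradient f) z0 = 0 -> gradient f (z0 + y) = 0) ->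
  exists2 r : R, 0 < r &
    forall z : nat -> 'rV[R]_k, norm2 (z 0%N - z0) < r -> LM_iterates f z ->
      exists2 zhat, gradient f zhat = 0 & converges_quadratically z zhat.
Proof.
move=> pf.
have [JG JGE] : exists J : 'rV[R]_k -> 'M[R]_k, forall x, 'J (gradient f) x = J x.
  by exists (fun x => 'J (gradient f) x).
have [K K1 gT] := polymap_taylor z0 pf.
have gT' : taylor_near (gradient f) JG z0 K.
  move=> a b az bz; have := gT a b az bz.
  by have [Ea Eb] := (JGE a, JGE b); rewrite Ea Eb.
rewrite JGE => gker.
have stepE z z' : LM_step f z z' -> exists dz, [/\ z' = z + dz,
    gradient f z = 0 -> dz = 0 & gradient f z <> 0 ->
    dz *m (JG z *m (JG z)^T + (norm2 (gradient f z))%:M) = - (gradient f z *m (JG z)^T)].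
  (* The Hessian is the transpose of the row-convention Jacobian J, so H^T H is the Gram matrix J
     J^T; transposing the normal equations makes them act on rows. *)
  rewrite /LM_step /hessian /jacobian_mx JGE trmxK => -[s0 s1].
  have [g0|/eqP g0] := eqVneq (gradient f z) 0.
    by exists 0; rewrite addr0 s0.
  have [dz [dzE ->]] := s1 g0; exists dz; split=> // _.
  apply: trmx_inj; rewrite trmx_mul linearD /= trmx_mul trmxK tr_scalar_mx dzE.
  by rewrite linearN /= trmx_mul trmxK.
move: (gradient f) gT' gker stepE => g gT' gker stepE.
have [P [C C1 [rho rho0 [PJ PC est]]]] := LM_step_estimate K1 gT' gker.
have C0 : 0 < C by exact: lt_le_trans C1.
exists (Num.min (1 / (2 * C ^+ 2)) (rho / (3 * C ^+ 2))).
  by rewrite lt_min !divr_gt0 ?mulr_gt0 ?exprn_gt0.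
move=> z zr zit.
have [||||//||zh [zcvg acvg zh1 zh2]] := @quadratic_decay_cvg R k z z0
  (fun i => `|(z i - z0) *m P|) C rho (norm2 (z 0%N - z0)) C1.
- by rewrite (le_trans (ltW zr)) // ge_min lexx.
- by rewrite (le_trans (ltW zr)) // ge_min lexx orbT.
- exact: ler_norm_norm2.
- exact: PC.
- move=> i zi; have [dz [-> h1 h2]] := stepE _ _ (zit i).
  by rewrite addrAC subrr add0r; exact: est.
(* Splitting zh - z0 at z i bounds its transverse part by (1 + 2 C^2) a i, which tends to 0; the
   limit is therefore in the affine set of zeros. *)
have zhP : (zh - z0) *m P = 0.
  apply/eqP; rewrite -normr_le0; apply/ler_addgt0Pr => e e0; rewrite add0r.
  have cv : (fun i => (1 + C * (2 * C)) * `|(z i - z0) *m P|) @ \oo --> (0 : R).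
    exact: cvg_mul_to0.
  have [i _ /(_ i (leqnn i)) Hi] := cvgr_lt _ cv _ e0.
  rewrite (le_trans _ (ltW Hi)) // mulrDl mul1r.
  rewrite (_ : zh - z0 = (z i - z0) - (z i - zh)); last first.
    by rewrite opprB [RHS]addrC subrKA.
  rewrite mulmxBl (le_trans (ler_normB _ _)) // lerD2l (le_trans (PC _)) //.
  by rewrite -mulrA ler_wpM2l ?(ltW C0).
exists zh.
  rewrite -(subrK z0 zh) addrC; apply: gker.
  by have := PJ (zh - z0); rewrite zhP subr0.
split=> //.
(* The factors come from passing to the Euclidean norm, from the distance to the limit, from the
   decay of a, and from the square of a i <= C |z i - zh|. *)
exists (k.+1%:R * (2 * C * (C * C ^+ 2))); near=> i.
rewrite (le_trans (ler_norm2_norm _)) // -[leRHS]mulrA ler_wpM2l //.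
rewrite (le_trans (zh1 _)) // -[leRHS]mulrA ler_wpM2l ?mulr_ge0 ?(ltW C0) //.
rewrite (le_trans (zh2 i)) // -[leRHS]mulrA ler_wpM2l ?(ltW C0) //.
rewrite -exprMn ler_pXn2r ?nnegrE ?mulr_ge0 ?norm2_ge0 ?(ltW C0) //.
have -> : (z i - z0) *m P = (z i - zh) *m P.
  by rewrite -(subrKA zh) mulmxDl zhP addr0.
rewrite (le_trans (PC _)) // ler_wpM2l ?(ltW C0) // ler_norm_norm2 //.
Unshelve. all: by end_near.
Qed.

(** * Stationary points of a Lagrangian *)

Lemma polymap_gradient (R : realType) k (f : 'rV[R]_k -> R) :
  polyfun f -> polymap (gradient f).
Proof.
move=> pf i; rewrite (_ : (fun x => _) = 'D_(delta_mx 0 i) f).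
  exact: polyfun_derive.
by apply/funext => x; rewrite mxE.
Qed.

Lemma derive_gradient_entry (R : realType) k (f : 'rV[R]_k -> R) x v i :
  'D_v (fun y => gradient f y 0 i) x = 'D_v ('D_(delta_mx 0 i) f) x.
Proof. by congr derive; apply/funext => y; rewrite mxE. Qed.

(** The difference quotients of the two sides coincide before the limit is taken. *)
Lemma derive_comp_linear (R : realType) (U V W : normedModType R)
    (l : {linear U -> V}) (f : V -> W) (x v : U) :
  'D_v (f \o l) x = 'D_(l v) f (l x).
Proof.
rewrite /derive (_ : (fun h => _) =
  (fun h => h^-1 *: (f (h *: l v + l x) - f (l x)))) //.
by apply/funext => h /=; rewrite linearP.
Qed.

(** The generic shape of [lagrangian_z], which unfolds to the instance with the squared Frobenius
    norm as F and [constr] as c. *)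
Definition lagr (R : realType) N M (F : 'rV[R]_N -> R) (c : 'rV[R]_N -> 'rV[R]_M)
    (z : 'rV[R]_(N + M)) : R :=
  F (lsubmx z) + dot (rsubmx z) (c (lsubmx z)).

Lemma dotE (R : realType) k (u v : 'rV[R]_k) : dot u v = \sum_j u 0 j * v 0 j.
Proof. by rewrite /dot mxE; apply: eq_bigr => j _; rewrite mxE. Qed.

Lemma polyfun_lsubmx (R : realType) N M (f : 'rV[R]_N -> R) :
  polyfun f -> polyfun (fun z : 'rV[R]_(N + M) => f (lsubmx z)).
Proof.
apply: polyfun_comp => i; under eq_fun do rewrite mxE; exact: polyfun_coord.
Qed.

Lemma polyfun_rsubmx (R : realType) N M (j : 'I_M) :
  polyfun (fun z : 'rV[R]_(N + M) => rsubmx z 0 j).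
Proof. under eq_fun do rewrite mxE; exact: polyfun_coord. Qed.

Lemma derive_lsubmx (R : realType) N M (f : 'rV[R]_N -> R) (z v : 'rV[R]_(N + M)) :
  'D_v (fun z => f (lsubmx z)) z = 'D_(lsubmx v) f (lsubmx z).
Proof. exact: (@derive_comp_linear R _ _ _ lsubmx). Qed.

Lemma derive_rsubmx (R : realType) N M (j : 'I_M) (z v : 'rV[R]_(N + M)) :
  'D_v (fun z : 'rV[R]_(N + M) => rsubmx z 0 j) z = rsubmx v 0 j.
Proof.
rewrite (_ : (fun z => _) = (fun z : 'rV[R]_(N + M) => z 0 (rshift N j))).
  by rewrite derive_coord mxE.
by apply/funext => y; rewrite mxE.
Qed.

Lemma lagrE (R : realType) N M (F : 'rV[R]_N -> R) (c : 'rV[R]_N -> 'rV[R]_M) :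
  lagr F c =
  fun z => F (lsubmx z) + \sum_j rsubmx z 0 j * c (lsubmx z) 0 j.
Proof. by apply/funext => z; rewrite /lagr dotE. Qed.

Lemma polyfun_lagr (R : realType) N M (F : 'rV[R]_N -> R) (c : 'rV[R]_N -> 'rV[R]_M) :
  polyfun F -> polymap c -> polyfun (lagr F c).
Proof.
move=> pF pc; rewrite lagrE; apply: polyfunD; first exact: polyfun_lsubmx.
apply: polyfun_sum => j; apply: polyfunM; first exact: polyfun_rsubmx.
exact: (polyfun_lsubmx _ (pc j)).
Qed.

Lemma derive_lagr (R : realType) N M (F : 'rV[R]_N -> R) (c : 'rV[R]_N -> 'rV[R]_M) v z :
  polyfun F -> polymap c ->
  'D_v (lagr F c) z = 'D_(lsubmx v) F (lsubmx z) +
    \sum_j (rsubmx z 0 j * 'D_(lsubmx v) (fun x => c x 0 j) (lsubmx z) +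
            c (lsubmx z) 0 j * rsubmx v 0 j).
Proof.
move=> pF pc; have pFl := polyfun_lsubmx M pF.
have pcl j := polyfun_lsubmx M (pc j); have pr j := @polyfun_rsubmx R N M j.
have pm j := polyfunM (pr j) (pcl j).
rewrite lagrE polyfun_derive_add //; last exact: polyfun_sum.
rewrite derive_lsubmx polyfun_derive_sum //; congr (_ + _); apply: eq_bigr => j _.
rewrite polyfun_derive_mul // derive_rsubmx.
by rewrite (@derive_lsubmx R N M (fun x => c x 0 j)).
Qed.

Lemma gradient_lagr_l (R : realType) N M (F : 'rV[R]_N -> R)
    (c : 'rV[R]_N -> 'rV[R]_M) z i :
  polyfun F -> polymap c ->
  'D_(delta_mx 0 (lshift M i)) (lagr F c) z = 'D_(delta_mx 0 i) F (lsubmx z) +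
    \sum_j rsubmx z 0 j * 'D_(delta_mx 0 i) (fun x => c x 0 j) (lsubmx z).
Proof.
move=> pF pc; rewrite derive_lagr //.
have -> : lsubmx (delta_mx 0 (lshift M i)) = delta_mx 0 i :> 'rV[R]_N.
  by apply/rowP => l; rewrite !mxE eq_lshift.
congr (_ + _); apply: eq_bigr => j _.
by rewrite !mxE eq_rlshift mulr0 addr0.
Qed.

Lemma gradient_lagr_r (R : realType) N M (F : 'rV[R]_N -> R)
    (c : 'rV[R]_N -> 'rV[R]_M) z j :
  polyfun F -> polymap c ->
  'D_(delta_mx 0 (rshift N j)) (lagr F c) z = c (lsubmx z) 0 j.
Proof.
move=> pF pc; rewrite derive_lagr //.
have -> : lsubmx (delta_mx 0 (rshift N j)) = 0 :> 'rV[R]_N.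
  by apply/rowP => l; rewrite !mxE eq_lrshift.
rewrite derive0 add0r (bigD1 j) //= big1 => [|l lj]; rewrite derive0 mulr0 !mxE.
  by rewrite eq_rshift !eqxx mulr1 add0r addr0.
by rewrite eq_rshift (negPf lj) andbF mulr0 add0r.
Qed.

(* Second-order sufficiency annihilates the x-part of [w], so [w] is (0, mu) with
   mu in ker J^T, and the gradient is affine in the multipliers. *)
Lemma lagr_hessian_kernel (R : realType) N M (F : 'rV[R]_N -> R)
    (c : 'rV[R]_N -> 'rV[R]_M) (xs : 'rV[R]_N) (ls : 'rV[R]_M) :
  polyfun F -> polymap c ->
  gradient (lagr F c) (row_mx xs ls) = 0 ->
  (forall y : 'rV[R]_N, y != 0 -> jacobian_mx c xs *m y^T = 0 ->
    0 < (y *m hessian (fun x => F x + dot ls (c x)) xs *m y^T) 0 0) ->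
  forall w, w *m 'J (gradient (lagr F c)) (row_mx xs ls) = 0 ->
    gradient (lagr F c) (row_mx xs ls + w) = 0.
Proof.
move=> pF pc gz sosc w wJ.
have pL := polyfun_lagr pF pc.
have wD i : 'D_w ('D_(delta_mx 0 i) (lagr F c)) (row_mx xs ls) = 0.
  rewrite -derive_gradient_entry -(polymap_jacobianE _ _ _ (polymap_gradient pL)).
  by rewrite wJ mxE.
pose y := lsubmx w; pose mu := rsubmx w.
pose dc i j := 'D_(delta_mx 0 i) (fun x => c x 0 j) xs.
(* The multiplier rows of the kernel equation: y lies in the kernel of the constraint Jacobian. *)
have yc j : 'D_y (fun x => c x 0 j) xs = 0.
  have := wD (rshift N j).
  rewrite (_ : 'D_(delta_mx 0 (rshift N j)) (lagr F c) = fun z => c (lsubmx z) 0 j).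
    by rewrite (@derive_lsubmx R N M (fun x => c x 0 j)) row_mxKl.
  by apply/funext => z; exact: gradient_lagr_r.
have pDF i := polyfun_derive (delta_mx 0 i) pF.
have pDc i j := polyfun_derive (delta_mx 0 i) (pc j).
have wx i : 'D_y ('D_(delta_mx 0 i) F) xs +
    \sum_j (ls 0 j * 'D_y ('D_(delta_mx 0 i) (fun x => c x 0 j)) xs +
            dc i j * mu 0 j) = 0.
  have := wD (lshift M i).
  (* A partial derivative of the Lagrangian in an x-variable is again a Lagrangian, for the
     differentiated F and c, so [derive_lagr] applies a second time. *)
  rewrite (_ : 'D_(delta_mx 0 (lshift M i)) (lagr F c) = lagr ('D_(delta_mx 0 i) F)
     (fun x => \row_j 'D_(delta_mx 0 i) (fun x => c x 0 j) x)).
    rewrite derive_lagr // ?row_mxKl ?row_mxKr => [h|j].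
      rewrite -[RHS]h; congr (_ + _); apply: eq_bigr => j _.
      congr (_ * _ + _ * _); last by rewrite mxE.
      by congr derive; apply/funext => x; rewrite mxE.
    by under eq_fun do rewrite mxE.
  apply/funext => z; rewrite gradient_lagr_l // lagrE; congr (_ + _).
  by apply: eq_bigr => j _; rewrite [X in _ = _ * X]mxE.
pose l x := F x + dot ls (c x).
have lE : l = fun x => F x + \sum_j ls 0 j * c x 0 j.
  by apply/funext => x; rewrite /l dotE.
have plc j : polyfun (fun x => ls 0 j * c x 0 j).
  by apply: polyfunM => //; exact: polyfun_cst.
have pl : polyfun l by rewrite lE; apply: polyfunD => //; exact: polyfun_sum.
have dl v x : 'D_v l x = 'D_v F x + \sum_j ls 0 j * 'D_v (fun x => c x 0 j) x.
  rewrite lE polyfun_derive_add //; last exact: polyfun_sum.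
  rewrite polyfun_derive_sum //; congr (_ + _); apply: eq_bigr => j _.
  rewrite polyfun_derive_mul //; last exact: polyfun_cst.
  by rewrite derive_cst mulr0 addr0.
have ydc j : \sum_i y 0 i * dc i j = 0.
  rewrite -[RHS](yc j) -(polymap_jacobianE _ _ _ pc) [RHS]mxE; apply: eq_bigr => i _.
  by rewrite polymap_jacobian_entry.
have y0 : y = 0.
  apply/eqP/negPn/negP => y0.
  have Jy : jacobian_mx c xs *m y^T = 0.
    rewrite /jacobian_mx -trmx_mul; apply/trmx_inj; rewrite trmxK trmx0.
    by apply/rowP => j; rewrite polymap_jacobianE // yc mxE.
  have := sosc y y0 Jy; rewrite -/l.
  (* By [wx] the quadratic form is minus the pairing of mu with J y, which vanishes by [ydc]; this
     contradicts second-order sufficiency. *)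
  have -> : (y *m hessian l xs *m y^T) 0 0 = 0; last by rewrite ltxx.
  transitivity (\sum_i y 0 i * 'D_y ('D_(delta_mx 0 i) l) xs).
    rewrite -mulmxA mxE; apply: eq_bigr => i _; congr (_ * _).
    rewrite /hessian /jacobian_mx -trmx_mul mxE.
    by rewrite (polymap_jacobianE _ _ _ (polymap_gradient pl)) derive_gradient_entry.
  transitivity (\sum_i (y 0 i * - \sum_j dc i j * mu 0 j)).
    apply: eq_bigr => i _; congr (_ * _).
    rewrite (_ : 'D_(delta_mx 0 i) l = fun x => 'D_(delta_mx 0 i) F x +
      \sum_j ls 0 j * 'D_(delta_mx 0 i) (fun x => c x 0 j) x); last first.
      by apply/funext => x; exact: dl.
    have pls j : polyfun (fun x => ls 0 j * 'D_(delta_mx 0 i) (fun x => c x 0 j) x).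
      by apply: polyfunM => //; exact: polyfun_cst.
    rewrite polyfun_derive_add //; last exact: polyfun_sum.
    rewrite polyfun_derive_sum //; apply/eqP; rewrite -addr_eq0 -addrA -big_split /=.
    rewrite -[X in _ == X](wx i); apply/eqP; congr (_ + _); apply: eq_bigr => j _.
    rewrite polyfun_derive_mul //; last exact: polyfun_cst.
    by rewrite derive_cst mulr0 addr0.
  under eq_bigr do rewrite mulrN mulr_sumr.
  rewrite sumrN exchange_big /= big1 ?oppr0 // => j _.
  by under eq_bigr do rewrite mulrA; rewrite -mulr_suml ydc mul0r.
have mudc i : \sum_j dc i j * mu 0 j = 0.
  have := wx i; rewrite y0 derive0 add0r => {2}<-; apply: eq_bigr => j _.
  by rewrite derive0 mulr0 add0r.
have wE : row_mx xs ls + w = row_mx xs (ls + mu).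
  by rewrite -[w]hsubmxK -/y -/mu y0 add_row_mx addr0.
apply/rowP => i; rewrite wE [RHS]mxE mxE.
have := congr1 (fun g : 'rV_(N + M) => g 0 i) gz; rewrite [RHS]mxE mxE.
case: (split_ordP i) => [i' ->|j ->].
  rewrite !gradient_lagr_l // !row_mxKl !row_mxKr => gi.
  under eq_bigr do rewrite mxE mulrDl.
  rewrite big_split /= addrA gi add0r -[RHS](mudc i').
  by apply: eq_bigr => j _; rewrite mulrC.
by rewrite !gradient_lagr_r // !row_mxKl.
Qed.

(** * Polynomiality of the problem data *)

(** Dependence on x is tested on every coefficient, whatever the degree, so the class is closed
    under the ring operations of [{poly R}] and truncation by [poly_rV] stays polynomial. *)
Definition coef_polyfun (R : realType) k (F : 'rV[R]_k -> {poly R}) :=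
  forall i, polyfun (fun x => (F x)`_i).

Lemma coef_polyfun_cst (R : realType) k (p : {poly R}) :
  coef_polyfun (fun _ : 'rV[R]_k => p).
Proof. by move=> i; exact: polyfun_cst. Qed.

Lemma coef_polyfunD (R : realType) k (F G : 'rV[R]_k -> {poly R}) :
  coef_polyfun F -> coef_polyfun G -> coef_polyfun (fun x => F x + G x).
Proof.
by move=> pF pG i; under eq_fun do rewrite coefD; exact: (polyfunD (pF i) (pG i)).
Qed.

Lemma coef_polyfunM (R : realType) k (F G : 'rV[R]_k -> {poly R}) :
  coef_polyfun F -> coef_polyfun G -> coef_polyfun (fun x => F x * G x).
Proof.
move=> pF pG i; under eq_fun do rewrite coefM.
by apply: polyfun_sum => j; exact: (polyfunM (pF _) (pG _)).
Qed.

Lemma coef_polyfunN (R : realType) k (F : 'rV[R]_k -> {poly R}) :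
  coef_polyfun F -> coef_polyfun (fun x => - F x).
Proof.
move=> pF; under eq_fun do rewrite -mulN1r.
exact: (coef_polyfunM (coef_polyfun_cst k (-1)) pF).
Qed.

Lemma coef_polyfunC (R : realType) k (f : 'rV[R]_k -> R) :
  polyfun f -> coef_polyfun (fun x => (f x)%:P).
Proof.
move=> pf [|i]; under eq_fun do rewrite coefC /=; [exact: pf|exact: polyfun_cst].
Qed.

Lemma coef_polyfun_sum (R : realType) k (I : Type) (r : seq I) (P : pred I)
    (F : I -> 'rV[R]_k -> {poly R}) :
  (forall i, coef_polyfun (F i)) ->
  coef_polyfun (fun x => \sum_(i <- r | P i) F i x).
Proof.
move=> pF; elim: r => [|i r IH].
  by under eq_fun do rewrite big_nil; exact: coef_polyfun_cst.
under eq_fun do rewrite big_cons.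
by case: (P i) => //; exact: (coef_polyfunD (pF i) IH).
Qed.

Lemma coef_polyfun_prod (R : realType) k (I : Type) (r : seq I) (P : pred I)
    (F : I -> 'rV[R]_k -> {poly R}) :
  (forall i, coef_polyfun (F i)) ->
  coef_polyfun (fun x => \prod_(i <- r | P i) F i x).
Proof.
move=> pF; elim: r => [|i r IH].
  by under eq_fun do rewrite big_nil; exact: coef_polyfun_cst.
under eq_fun do rewrite big_cons.
by case: (P i) => //; exact: (coef_polyfunM (pF i) IH).
Qed.

(** Leibniz's expansion: a signed sum of products of entries. *)
Lemma coef_polyfun_det (R : realType) k n (M : 'rV[R]_k -> 'M[{poly R}]_n) :
  (forall i j, coef_polyfun (fun x => M x i j)) ->
  coef_polyfun (fun x => \det (M x)).
Proof.
move=> pM; apply: coef_polyfun_sum => s.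
apply: coef_polyfunM; first exact: coef_polyfun_cst.
exact: coef_polyfun_prod.
Qed.

Lemma coef_polyfun_adj (R : realType) k n (M : 'rV[R]_k -> 'M[{poly R}]_n) i j :
  (forall i j, coef_polyfun (fun x => M x i j)) ->
  coef_polyfun (fun x => (\adj (M x)) i j).
Proof.
move=> pM; under eq_fun do rewrite mxE.
apply: coef_polyfunM; first exact: coef_polyfun_cst.
apply: coef_polyfun_det => a b; under eq_fun do rewrite !mxE.
exact: pM.
Qed.

Lemma coef_polyfun_lincomb (R : realType) k n p (B : 'I_p -> 'M[{poly R}]_n)
    (u : 'rV[R]_k -> 'rV[R]_p) i j :
  polymap u -> coef_polyfun (fun x => lincomb B (u x) i j).
Proof.
move=> pu; under eq_fun do rewrite /lincomb summxE.
apply: coef_polyfun_sum => l; under eq_fun do rewrite mxE.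
by apply: coef_polyfunM; [exact: coef_polyfunC|exact: coef_polyfun_cst].
Qed.

Lemma coef_polyfun_rVpoly (R : realType) k e (u : 'rV[R]_k -> 'rV[R]_e) :
  polymap u -> coef_polyfun (fun x => rVpoly (u x)).
Proof.
move=> pu i; under eq_fun do rewrite coef_rVpoly.
by case: insub => [j|]; [exact: pu|exact: polyfun_cst].
Qed.

Lemma coef_polyfun_unvecmx (R : realType) k n e
    (u : 'rV[R]_k -> 'rV[R]_(n * n * e.+1)) i j :
  polymap u -> coef_polyfun (fun x => unvecmx (u x) i j).
Proof.
move=> pu; under eq_fun do rewrite !mxE.
apply: coef_polyfun_rVpoly => l; under eq_fun do rewrite !mxE.
exact: pu.
Qed.

Lemma polymap_vecmx (R : realType) k n e (M : 'rV[R]_k -> 'M[{poly R}]_n) :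
  (forall i j, coef_polyfun (fun x => M x i j)) ->
  polymap (fun x => vecmx e (M x)).
Proof.
move=> pM l; rewrite /vecmx; case/mxvec_indexP: l => a b.
under eq_fun do rewrite mxvecE !mxE.
by case/mxvec_indexP: a => i j; under eq_fun do rewrite mxvecE mxE; exact: pM.
Qed.

Lemma polymap_lsubmx (R : realType) k a b (u : 'rV[R]_k -> 'rV[R]_(a + b)) :
  polymap u -> polymap (fun x => lsubmx (u x)).
Proof. by move=> pu i; under eq_fun do rewrite mxE; exact: pu. Qed.

Lemma polymap_rsubmx (R : realType) k a b (u : 'rV[R]_k -> 'rV[R]_(a + b)) :
  polymap u -> polymap (fun x => rsubmx (u x)).
Proof. by move=> pu i; under eq_fun do rewrite mxE; exact: pu. Qed.

Lemma polymap_id (R : realType) k : polymap (fun x : 'rV[R]_k => x).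
Proof. by move=> i; exact: polyfun_coord. Qed.

Lemma polymap_row_mx (R : realType) k a b (u : 'rV[R]_k -> 'rV[R]_a)
    (v : 'rV[R]_k -> 'rV[R]_b) :
  polymap u -> polymap v -> polymap (fun x => row_mx (u x) (v x)).
Proof.
move=> pu pv i; case: (split_ordP i) => [j ->|j ->].
  by under eq_fun do rewrite row_mxEl; exact: pu.
by under eq_fun do rewrite row_mxEr; exact: pv.
Qed.

Lemma polyfun_dot (R : realType) k l (u v : 'rV[R]_k -> 'rV[R]_l) :
  polymap u -> polymap v -> polyfun (fun x => dot (u x) (v x)).
Proof.
move=> pu pv; under eq_fun do rewrite dotE.
by apply: polyfun_sum => j; exact: (polyfunM (pu j) (pv j)).
Qed.

(** Squaring removes the root in [norm2] and leaves a sum of squares of coefficients, each linear in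
    x. *)
Lemma polyfun_objective (R : realType) n d m p (B : 'I_p -> 'M[{poly R}]_n) :
  polyfun (fun x : 'rV[R]_(nvars n d m p) => frob d (dA B x) ^+ 2).
Proof.
under eq_fun do rewrite sqr_norm2.
have pv : polymap (fun x : 'rV[R]_(nvars n d m p) => vecmx d (dA B x)).
  apply: polymap_vecmx => i j; apply: coef_polyfun_lincomb.
  exact/polymap_lsubmx/polymap_id.
exact: polyfun_dot.
Qed.

Lemma polymap_constr (R : realType) n d m p (A : 'M[{poly R}]_n)
    (B : 'I_p -> 'M[{poly R}]_n) (Nh : 'rV[R]_m.+1) :
  polymap (@constr R n d m p A B Nh).
Proof.
have pr := polymap_rsubmx (@polymap_id R (nvars n d m p)).
have ph : coef_polyfun (@hpart R n d m p).
  exact/coef_polyfun_rVpoly/polymap_rsubmx.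
apply: polymap_row_mx.
  apply: polymap_vecmx => i j.
  under eq_fun do rewrite mxE [X in _ + X]mxE [X in _ - X]mxE.
  apply: coef_polyfunD.
    apply: coef_polyfun_adj => a b; under eq_fun do rewrite mxE.
    apply: coef_polyfunD; first exact: coef_polyfun_cst.
    exact/coef_polyfun_lincomb/polymap_lsubmx/polymap_id.
  apply: coef_polyfunN; apply: coef_polyfunM => //.
  exact/coef_polyfun_unvecmx/polymap_lsubmx.
move=> i; under eq_fun do rewrite mxE.
apply: polyfunD; last exact: polyfun_cst.
rewrite /normalize; under eq_fun do rewrite mxE.
apply: polyfun_sum => j; apply: polyfunM; first exact: polyfun_cst.
under eq_fun do rewrite !mxE; exact: ph.
Qed.

Theorem corollary4p6 (R : realType) (n d m p : nat)
    (A : 'M[{poly R}]_n) (V : set 'M[{poly R}]_n)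
    (B : 'I_p -> 'M[{poly R}]_n) (Nh : 'rV[R]_m.+1)
    (xstar : 'rV[R]_(nvars n d m p)) (lamstar : 'rV[R]_(nconstr n d))
    (hA : deg_le d A)
    (hV : linear_subspace d V)
    (hB : orthonormal_basis d V B)
    (hm : (1 <= m <= adj_deg n d)%N)
    (hNh : nonconstant_normalization Nh)
    (hx : is_solution A B Nh xstar)
    (hlam : gradient (lagrangian_z A B Nh) (row_mx xstar lamstar) = 0)
    (hsosc : second_order_sufficient A B Nh xstar lamstar) :
  exists2 r : R, 0 < r &
    forall z : nat -> 'rV[R]_(nvars n d m p + nconstr n d),
      norm2 (z 0%N - row_mx xstar lamstar) < r ->
      LM_iterates (lagrangian_z A B Nh) z ->
      exists2 zhat, gradient (lagrangian_z A B Nh) zhat = 0 &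
        converges_quadratically z zhat.
Proof.
have pF := @polyfun_objective R n d m p B.
have pc := @polymap_constr R n d m p A B Nh.
apply: LM_local_quadratic_convergence.
  exact: (polymap_gradient (polyfun_lagr pF pc)).
(* Second-order sufficiency supplies the affine family of stationary points through the given one,
   along the kernel of the Hessian, that the convergence argument requires. *)
exact: (lagr_hessian_kernel pF pc hlam hsosc).
Qed.
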